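(* (ES4 scheme.) Let $Q(t)\in\mathbb{C}^{N\times N}$ be sufficiently smooth. (a) With $Q,Q^{(1)},Q^{(2)}$ evaluated at $t$, the matrix $$\exp\left\{\tau Q+\tau^3\left[\tfrac{1}{24}Q^{(2)}+\tfrac{1}{12}\left(Q^{(1)}Q-QQ^{(1)}\right)\right]\right\}$$ equals, up to $O(\tau^5)$ as $\tau\to0$, $$E+\tau Q+\tfrac{\tau^2}{2}Q^2+\tfrac{\tau^3}{6}Q^3+\tfrac{\tau^3}{24}Q^{(2)}+\tfrac{\tau^3}{12}\left(Q^{(1)}Q-QQ^{(1)}\right)+\tfrac{\tau^4}{24}Q^4+\tfrac{\tau^4}{48}\left(QQ^{(2)}+Q^{(2)}Q\right)+\tfrac{\tau^4}{24}\left(Q^{(1)}Q^2-Q^2Q^{(1)}\right).$$ (b) Let $T_{\mathrm{ES4}}(\tau)$ be the exponential in (a) with $Q^{(1)}$ and $Q^{(2)}$ replaced by the central differences $\frac{Q(t+\tau)-Q(t-\tau)}{2\tau}$ and $\frac{Q(t+\tau)-2Q(t)+Q(t-\tau)}{\tau^2}$. Then the one-step scheme from $t-\tau/2$ to $t+\tau/2$ with transition matrix $T_{\mathrm{ES4}}$ has fourth order of accuracy for $dx/dt=Q(t)x$. (c) For the Zakharov–Shabat matrix $Q(t)=\begin{pmatrix}-i\zeta&q(t)\\-\sigma q(t)^*&i\zeta\end{pmatrix}$ with $\sigma\in\{1,-1\}$ and real spectral parameter $\zeta=\xi\in\mathbb{R}$, the scheme $T_{\mathrm{ES4}}$ conserves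 the quadratic invariant: if $\Psi'=T_{\mathrm{ES4}}\Psi$ for $\Psi\in\mathbb{C}^2$, then $H(\Psi')=H(\Psi)$, where $H(\Psi)=|\psi_1|^2+\sigma|\psi_2|^2$.
   Context: $E$ is the identity matrix, $Q^{(k)}=d^kQ/dt^k$, and $q:\mathbb{R}\to\mathbb{C}$ is the potential, with $q^*$ its complex conjugate; $\Psi=(\psi_1,\psi_2)^T$. A one-step scheme with transition matrix $T(\tau)$ from $t-\tau/2$ to $t+\tau/2$ has fourth order of accuracy for $dx/dt=Q(t)x$ if for every exact solution $x$ one has $x(t+\tau/2)=T(\tau)\,x(t-\tau/2)+O(\tau^5)$ as $\tau\to0$ with $t$ fixed. *)

(* Defs.v *)
From HB Require Import structures.
From mathcomp Require Import all_boot all_order all_algebra.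
From mathcomp Require Import complex.
From mathcomp Require Import all_classical all_reals all_analysis.

Set Implicit Arguments.
Unset Strict Implicit.
Unset Printing Implicit Defensive.

Import Order.TTheory GRing.Theory Num.Theory.
Import numFieldNormedType.Exports.
Local Open Scope classical_set_scope.
Local Open Scope ring_scope.
Local Open Scope complex_scope.

(* R[i] with the topology of its modulus; R[i]-valued matrices then carry the
   library's max-norm over the field R[i]. *)
HB.instance Definition _ (R : rcfType) := NormedModule.copy R[i] R[i]^o.

Section Calculus.
Context {R : realType} {m n : nat}.
Implicit Types (F : R -> 'M[R[i]]_(m, n)) (t : R).

(* The library's derive1 needs a codomain normed over R, whereas complex
   matrices are normed over R[i]: hence derivatives with respect to a real
   variable are restated here with the same difference quotient. *)
Definition mxquot F t : R -> 'M[R[i]]_(m, n) :=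
  fun h => (h^-1)%:C *: (F (h + t) - F t).

Definition mxderivable F t := cvg (mxquot F t @ 0^').

Definition mxderive1 F : R -> 'M[R[i]]_(m, n) :=
  fun t => lim (mxquot F t @ 0^').

Definition mxderiven k F : R -> 'M[R[i]]_(m, n) := iter k mxderive1 F.

(* F is of class C^k on the whole real line. *)
Definition mxCk k F :=
  (forall j, (j < k)%N -> forall t, mxderivable (mxderiven j F) t) /\
  continuous (mxderiven k F).

End Calculus.

Section Schemes.
Context {R : realType} {N : nat}.
Local Notation M := 'M[R[i]]_N.
Implicit Types (Q : R -> M) (A : M) (t tau : R).

Definition mxexp A : M := limn (series (fun k : nat => (k`!%:R)^-1 *: A ^+ k)).

Definition exact_solution Q (x : R -> 'cV[R[i]]_N) :=
  forall s, mxderivable x s /\ mxderive1 x s = Q s *m x s.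

(* T t tau is the transition matrix from t - tau / 2 to t + tau / 2.
   0^' is the filter of punctured neighbourhoods of 0, so tau -> 0 through both
   signs. *)
Definition order_of_accuracy (p : nat) Q (T : R -> R -> M) :=
  forall x, exact_solution Q x -> forall t,
    (fun tau => x (t + tau / 2) - T t tau *m x (t - tau / 2))
      =O_ (0^') (fun tau => tau%:C ^+ p.+1 : R[i]).

Definition ES4_exponent tau (Q0 Q1 Q2 : M) : M :=
  tau%:C *: Q0
  + tau%:C ^+ 3 *: (24%:R^-1 *: Q2 + 12%:R^-1 *: (Q1 *m Q0 - Q0 *m Q1)).

Definition ES4_expansion tau (Q0 Q1 Q2 : M) : M :=
  1%:M
  + tau%:C *: Q0
  + (tau%:C ^+ 2 / 2%:R) *: Q0 ^+ 2
  + (tau%:C ^+ 3 / 6%:R) *: Q0 ^+ 3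
  + (tau%:C ^+ 3 / 24%:R) *: Q2
  + (tau%:C ^+ 3 / 12%:R) *: (Q1 *m Q0 - Q0 *m Q1)
  + (tau%:C ^+ 4 / 24%:R) *: Q0 ^+ 4
  + (tau%:C ^+ 4 / 48%:R) *: (Q0 *m Q2 + Q2 *m Q0)
  + (tau%:C ^+ 4 / 24%:R) *: (Q1 *m Q0 ^+ 2 - Q0 ^+ 2 *m Q1).

Definition central_diff1 Q t tau : M :=
  ((2 * tau)^-1)%:C *: (Q (t + tau) - Q (t - tau)).

Definition central_diff2 Q t tau : M :=
  ((tau ^+ 2)^-1)%:C *: (Q (t + tau) - 2%:R *: Q t + Q (t - tau)).

Definition T_ES4 Q t tau : M :=
  mxexp (ES4_exponent tau (Q t) (central_diff1 Q t tau)
                                (central_diff2 Q t tau)).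

End Schemes.

Section ZakharovShabat.
Context {R : realType}.

Definition ZS_matrix (sigma : R) (q : R -> R[i]) (zeta : R[i]) (t : R) :
    'M[R[i]]_2 :=
  \matrix_(i < 2, j < 2)
    if i == 0 then (if j == 0 then - 'i * zeta else q t)
    else (if j == 0 then - sigma%:C * (q t)^* else 'i * zeta).

(* The norm of R[i] takes its values in R[i], as nonnegative reals. *)
Definition ZS_invariant (sigma : R) (Psi : 'cV[R[i]]_2) : R[i] :=
  `|Psi 0 0| ^+ 2 + sigma%:C * `|Psi 1 0| ^+ 2.

End ZakharovShabat.

(* Main.v *)
(* All errors are tracked as expansions: F(tau) = sum_(k < d) tau^k a_k + O(tau^d),
   with noncommuting matrix coefficients that multiply by convolution.
   For (a), the exponent has coefficients (0, Q, 0, B, 0), and since it is O(tau)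
   only the powers below 5 of the exponential series matter.
   For (b), integrating x' = Q x term by term gives x(t + s) = sum c_k s^k with
   (k + 1) c_(k+1) = sum_i q_i c_(k-i), where q_i are the Taylor coefficients of Q
   at t; the central differences perturb the exponent by O(tau^5) only, and the
   claim becomes an identity between the coefficients of T(tau) x(t - tau/2) and
   x(t + tau/2).
   For (c), the exponent A lies in su(2) or su(1,1), according to sigma, so
   A^2 = mu E with mu real.  The partial sums of exp A are then C_n E + S_n A with
   C_n and S_n real, they scale the invariant by C_n^2 - mu S_n^2, and this tends
   to cosh^2 - sinh^2 = 1 or cos^2 + sin^2 = 1, according to the sign of mu. *)
Require Import Defs.
From mathcomp Require Import all_boot all_order all_algebra.
From mathcomp Require Import complex.
From mathcomp Require Import all_classical all_reals all_analysis.
From mathcomp Require Import ring lra.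

Set Implicit Arguments.
Unset Strict Implicit.
Unset Printing Implicit Defensive.

Import Order.TTheory GRing.Theory Num.Theory.
Import numFieldNormedType.Exports.
Local Open Scope classical_set_scope.
Local Open Scope ring_scope.
Local Open Scope complex_scope.

Local Notation Re := complex.Re.
Local Notation Im := complex.Im.

(** * A real-valued, submultiplicative norm on complex matrices *)

Section EntrywiseNorm.
Context {R : realType}.
Implicit Types z w : R[i].

(* Submultiplicative, like the modulus, but free of square roots: estimates and
   derivatives reduce to the real and imaginary parts. *)
Definition absc z : R := `|Re z| + `|Im z|.

Lemma absc_ge0 z : 0 <= absc z.
Proof. by rewrite addr_ge0. Qed.

Lemma abscD z w : absc (z + w) <= absc z + absc w.
Proof.
case: z w => a b [c d]; rewrite /absc /=.
by rewrite addrACA lerD // ler_normD.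
Qed.

Lemma abscN z : absc (- z) = absc z.
Proof. by case: z => a b; rewrite /absc /= !normrN. Qed.

Lemma abscM z w : absc (z * w) <= absc z * absc w.
Proof.
case: z w => a b [c d]; rewrite /absc /=.
rewrite mulrDl !mulrDr -!normrM.
have := ler_normB (a * c) (b * d); have := ler_normD (a * d) (b * c).
lra.
Qed.

Lemma abscR (r : R) z : absc (r%:C * z) = `|r| * absc z.
Proof.
case: z => a b; rewrite /absc /= !mul0r subr0 addr0.
by rewrite !normrM mulrDr.
Qed.

Lemma absc0 : absc (0 : R[i]) = 0.
Proof. by rewrite /absc /= normr0 addr0. Qed.

Lemma normc_le_absc z : `|z| <= (absc z)%:C.
Proof.
case: z => a b; rewrite normc_def /absc /= lecR.
rewrite -[leRHS]ger0_norm ?addr_ge0 // -sqrtr_sqr ler_wsqrtr //.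
rewrite sqrrD !real_normK ?num_real //.
by rewrite lerD2r lerDl mulrn_wge0 // mulr_ge0.
Qed.

Lemma normRe_le z : `|Re z|%:C <= `|z|.
Proof. exact: normc_ge_Re. Qed.

Lemma normIm_le z : `|Im z|%:C <= `|z|.
Proof.
case: z => a b; rewrite normc_def /= lecR.
by rewrite -sqrtr_sqr ler_wsqrtr // lerDr sqr_ge0.
Qed.

Context {m n p : nat}.
Implicit Types A B : 'M[R[i]]_(m, n).

(** The dimensions are bound anew so that one norm serves all matrix shapes that occur in a
    product. *)
Definition mxl1 m n (A : 'M[R[i]]_(m, n)) : R := \sum_i \sum_j absc (A i j).

Lemma mxl1_ge0 A : 0 <= mxl1 A.
Proof. by do 2![apply: sumr_ge0 => ? _]; exact: absc_ge0. Qed.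

Lemma mxl1D A B : mxl1 (A + B) <= mxl1 A + mxl1 B.
Proof.
rewrite /mxl1 -big_split ler_sum //= => i _; rewrite -big_split ler_sum //= => j _.
by rewrite mxE abscD.
Qed.

Lemma mxl1N A : mxl1 (- A) = mxl1 A.
Proof. by do 2![apply: eq_bigr => ? _]; rewrite mxE abscN. Qed.

Lemma mxl1_0 : mxl1 (0 : 'M[R[i]]_(m, n)) = 0.
Proof. by do 2![apply: big1 => ? _]; rewrite mxE absc0. Qed.

Lemma mxl1Z z A : mxl1 (z *: A) <= absc z * mxl1 A.
Proof.
rewrite /mxl1 mulr_sumr ler_sum // => i _; rewrite mulr_sumr ler_sum // => j _.
by rewrite mxE abscM.
Qed.

Lemma mxl1ZR (r : R) A : mxl1 (r%:C *: A) = `|r| * mxl1 A.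
Proof.
rewrite /mxl1 mulr_sumr; apply: eq_bigr => i _; rewrite mulr_sumr.
by apply: eq_bigr => j _; rewrite mxE abscR.
Qed.

Lemma absc_le_mxl1 A i j : absc (A i j) <= mxl1 A.
Proof.
rewrite /mxl1 (bigD1 i) //= (bigD1 j) //= -addrA lerDl.
by rewrite addr_ge0 //; do ?[apply: sumr_ge0 => ? _]; exact: absc_ge0.
Qed.

Lemma mxl1M A (B : 'M[R[i]]_(n, p)) : mxl1 (A *m B) <= mxl1 A * mxl1 B.
Proof.
have row_le k : \sum_j absc (B k j) <= mxl1 B.
  rewrite /mxl1 [leRHS](bigD1 k) //= lerDl.
  by do 2![apply: sumr_ge0 => ? _]; exact: absc_ge0.
rewrite {1 2}/mxl1 mulr_suml ler_sum // => i _.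
apply: (@le_trans _ _ (\sum_j \sum_k absc (A i k) * absc (B k j))).
  rewrite ler_sum // => j _; rewrite mxE.
  apply: (big_ind2 (fun x y => absc x <= y)); first by rewrite absc0.
  - by move=> x1 x2 y1 y2 h1 h2; apply: le_trans (abscD _ _) _; exact: lerD.
  - by move=> k _; exact: abscM.
rewrite exchange_big mulr_suml ler_sum //= => k _.
by rewrite -mulr_sumr ler_wpM2l ?absc_ge0.
Qed.

(** The max-norm of a nonzero matrix is attained at an entry, whose modulus is at most its
    [absc]. *)
Lemma norm_le_mxl1 A : `|A| <= (mxl1 A)%:C.
Proof.
have [->|A0] := eqVneq A 0; first by rewrite normr0 mxl1_0.
have [|[i j] /= Aij] := @mx_norm_neq0 _ _ _ A.
  by apply: contra_neq A0 => /mx_norm_eq0.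
rewrite [leLHS]/Num.norm /= Aij (le_trans (normc_le_absc _)) //.
by rewrite lecR absc_le_mxl1.
Qed.

End EntrywiseNorm.

(** * Expansions at 0 *)

Section BigO.
Context {R : realType}.

(** A big-O relation with real bounds, convenient for estimates; [OtauP] converts it to the relation
    of the theorem, whose norms lie in [R[i]]. *)
Definition Otau m n k (F : R -> 'M[R[i]]_(m, n)) :=
  exists C : R, \forall tau \near 0^', mxl1 (F tau) <= C * `|tau| ^+ k.

Lemma dnbhs0_near (P : R -> Prop) :
  (\forall tau \near 0^', P tau) <->
  exists2 e, 0 < e & forall tau, tau != 0 -> `|tau| < e -> P tau.
Proof.
split=> [[e /= e0 H]|[e e0 H]]; exists e => // tau.
- by move=> tau0 taue; apply: H => //=; rewrite sub0r normrN.
- by rewrite /= sub0r normrN => taue tau0; exact: H.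
Qed.

Context {m n p : nat}.
Implicit Types (F G : R -> 'M[R[i]]_(m, n)) (k l : nat) (c : R).

Lemma Otau_ge0 k F : Otau k F ->
  exists2 C : R, 0 <= C & \forall tau \near 0^', mxl1 (F tau) <= C * `|tau| ^+ k.
Proof.
move=> [C H]; exists `|C| => //; apply: filterS H => tau /le_trans; apply.
by rewrite ler_wpM2r ?exprn_ge0 // ler_norm.
Qed.

Lemma Otau_eq k F G : (forall tau, tau != 0 -> F tau = G tau) ->
  Otau k F -> Otau k G.
Proof.
move=> FG [C /dnbhs0_near[e e0 H]]; exists C; apply/dnbhs0_near; exists e => //.
by move=> tau tau0 taue; rewrite -FG //; exact: H.
Qed.

Lemma OtauD k F G : Otau k F -> Otau k G -> Otau k (fun tau => F tau + G tau).
Proof.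
move=> [C HF] [D HG]; exists (C + D); apply: filterS2 HF HG => tau HF HG.
by rewrite mulrDl (le_trans (mxl1D _ _)) // lerD.
Qed.

Lemma OtauN k F : Otau k F -> Otau k (fun tau => - F tau).
Proof. by move=> [C H]; exists C; apply: filterS H => tau; rewrite mxl1N. Qed.

Lemma OtauB k F G : Otau k F -> Otau k G -> Otau k (fun tau => F tau - G tau).
Proof. by move=> HF HG; apply: OtauD => //; exact: OtauN. Qed.

Lemma Otau0 k : Otau k (fun=> 0 : 'M[R[i]]_(m, n)).
Proof. by exists 0; apply: filterE => tau; rewrite mxl1_0 mul0r. Qed.

Lemma Otau_sum k (I : finType) (F : I -> R -> 'M[R[i]]_(m, n)) :
  (forall i, Otau k (F i)) -> Otau k (fun tau => \sum_i F i tau).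
Proof.
move=> HF.
have -> : (fun tau => \sum_i F i tau) = \sum_i F i.
  by apply/funext => tau; rewrite fct_sumE.
apply: (big_ind (fun F => Otau k F)) => [|G H|i _]; [exact: Otau0|exact: OtauD|].
exact: HF.
Qed.

Lemma Otau_le k l F : (l <= k)%N -> Otau k F -> Otau l F.
Proof.
move=> lk /Otau_ge0[C C0 /dnbhs0_near[e e0 H]].
(* Below 1, the higher power of [|tau|] is the smaller one. *)
exists C; apply/dnbhs0_near; exists (Num.min e 1).
  by rewrite lt_min e0 ltr01.
move=> tau tau0; rewrite lt_min => /andP[taue tau1].
rewrite (le_trans (H _ tau0 taue)) // ler_wpM2l //.
by apply: ler_wiXn2l => //; exact: ltW.
Qed.

Lemma OtauM k l F (G : R -> 'M[R[i]]_(n, p)) :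
  Otau k F -> Otau l G -> Otau (k + l) (fun tau => F tau *m G tau).
Proof.
move=> [C HF] [D HG]; exists (C * D); apply: filterS2 HF HG => tau HF HG.
rewrite exprD mulrACA (le_trans (mxl1M _ _)) // ler_pM //; exact: mxl1_ge0.
Qed.

Lemma OtauXZ k l F : Otau l F -> Otau (k + l) (fun tau => tau%:C ^+ k *: F tau).
Proof.
move=> [C HF]; exists C; apply: filterS HF => tau HF.
by rewrite -rmorphXn mxl1ZR normrX exprD mulrCA ler_wpM2l // exprn_ge0.
Qed.

Lemma Otau_cst (A : 'M[R[i]]_(m, n)) : Otau 0 (fun=> A).
Proof. by exists (mxl1 A); apply: filterE => tau; rewrite expr0 mulr1. Qed.

Lemma OtauX k (A : 'M[R[i]]_(m, n)) : Otau k (fun tau => tau%:C ^+ k *: A).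
Proof. by rewrite -[X in Otau X]addn0; exact: OtauXZ (Otau_cst _). Qed.

Lemma OtauZ k (z : R[i]) F : Otau k F -> Otau k (fun tau => z *: F tau).
Proof.
move=> [C HF]; exists (absc z * C); apply: filterS HF => tau HF.
by rewrite (le_trans (mxl1Z _ _)) // -mulrA ler_wpM2l ?absc_ge0.
Qed.

(** Serves [c = -1] in the central differences and [c = 1/2], [c = -1/2] at the ends of a step. *)
Lemma Otau_dilate k c F : c != 0 -> Otau k F -> Otau k (fun tau => F (c * tau)).
Proof.
move=> c0 [C /dnbhs0_near[e e0 H]]; exists (C * `|c| ^+ k).
apply/dnbhs0_near; exists (e / `|c|); first by rewrite divr_gt0 ?normr_gt0.
move=> tau tau0; rewrite ltr_pdivlMr ?normr_gt0 // -normrM mulrC => taue.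
by rewrite -mulrA -exprMn -normrM H // mulf_neq0.
Qed.

Lemma OtauP k F : Otau k F ->
  F =O_ (0^') (fun tau : R => tau%:C ^+ k : R[i]).
Proof.
(* A positive constant is required, while [C] may be 0. *)
move=> /Otau_ge0[C C0 H]; apply/eqO_exP; exists (C + 1)%:C.
  by rewrite ltcR ltr_wpDl.
apply: filterS H => tau H; rewrite (le_trans (norm_le_mxl1 _)) //.
rewrite normrX normc_def /= expr0n /= addr0 sqrtr_sqr -rmorphXn -rmorphM lecR.
by rewrite (le_trans H) // ler_wpM2r ?exprn_ge0 // lerDl.
Qed.

End BigO.

(** * Expansions in powers of [tau] and their products *)

Definition mxconv (K : pzSemiRingType) m n p (a : nat -> 'M[K]_(m, n))
    (b : nat -> 'M[K]_(n, p)) (k : nat) : 'M[K]_(m, p) :=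
  \sum_(i < k.+1) a i *m b (k - i)%N.

Section Expansion.
Context {R : realType}.

(** Only the coefficients below [d] enter, so a finite list read by [nth 0] can serve as the
    sequence [a]. *)
Definition expansion m n d (a : nat -> 'M[R[i]]_(m, n)) (F : R -> 'M[R[i]]_(m, n)) :=
  Otau d (fun tau => F tau - \sum_(k < d) tau%:C ^+ k *: a k).

Context {m n p : nat}.
Implicit Types (a b : nat -> 'M[R[i]]_(m, n)) (F G : R -> 'M[R[i]]_(m, n)) (d : nat).

Lemma expansion_eq d a b F G : (forall k, (k < d)%N -> a k = b k) ->
  (forall tau, tau != 0 -> F tau = G tau) -> expansion d a F -> expansion d b G.
Proof.
move=> ab FG; apply: Otau_eq => tau tau0; rewrite FG //; congr (_ - _).
by apply: eq_bigr => k _; rewrite ab.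
Qed.

Lemma Otau_poly d a : Otau 0 (fun tau => \sum_(k < d) tau%:C ^+ k *: a k).
Proof. by apply: Otau_sum => k; apply: Otau_le (OtauX _ _). Qed.

Lemma expansion_bounded d a F : expansion d a F -> Otau 0 F.
Proof.
move=> /(@Otau_le _ _ _ _ 0 _ (leq0n _))/OtauD/(_ (Otau_poly d a)).
by apply: Otau_eq => tau _; rewrite subrK.
Qed.

(** The dropped terms, of degree at least [e], are themselves O(tau^e). *)
Lemma expansion_le d e a F : (e <= d)%N -> expansion d a F -> expansion e a F.
Proof.
move=> ed HF; have : Otau e (fun tau =>
    \sum_(k < d) (if (e <= k)%N then tau%:C ^+ k *: a k else 0)).
  apply: Otau_sum => k; case: leqP => ek; last exact: Otau0.
  by apply: Otau_le ek _; exact: OtauX.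
move=> /(OtauD (Otau_le ed HF)); apply: Otau_eq => tau _.
rewrite -addrA; congr (_ + _); rewrite (big_ord_widen _ (fun k => tau%:C ^+ k *: a k) ed).
rewrite addrC -sumrB [in RHS]big_mkcond -sumrN.
by apply: eq_bigr => k _; rewrite ltnNge; case: leqP => _; rewrite ?subrr ?sub0r ?oppr0.
Qed.

Lemma expansionD d a b F G : expansion d a F -> expansion d b G ->
  expansion d (fun k => a k + b k) (fun tau => F tau + G tau).
Proof.
move=> HF HG; apply: Otau_eq (OtauD HF HG) => tau _.
rewrite addrACA -opprD -big_split; congr (_ - _).
by apply: eq_bigr => k _; rewrite scalerDr.
Qed.

Lemma expansionZ d z a F : expansion d a F ->
  expansion d (fun k => z *: a k) (fun tau => z *: F tau).
Proof.
move=> HF; apply: Otau_eq (OtauZ z HF) => tau _.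
rewrite scalerBr scaler_sumr; congr (_ - _).
by apply: eq_bigr => k _; rewrite !scalerA mulrC.
Qed.

Lemma expansion_poly d a : expansion d a (fun tau => \sum_(k < d) tau%:C ^+ k *: a k).
Proof. by apply: Otau_eq (Otau0 _) => tau _; rewrite subrr. Qed.

Lemma expansion_Otau d a F G : expansion d a F -> expansion d a G ->
  Otau d (fun tau => F tau - G tau).
Proof.
by move=> HF HG; apply: Otau_eq (OtauB HF HG) => tau _; rewrite opprB addrA subrK.
Qed.

Lemma Otau_expansion d a F G : Otau d (fun tau => F tau - G tau) ->
  expansion d a G -> expansion d a F.
Proof.
by move=> H HG; apply: Otau_eq (OtauD H HG) => tau _; rewrite addrA subrK.
Qed.

Lemma expansion_dilate d c a F : c != 0 -> expansion d a F ->
  expansion d (fun k => c%:C ^+ k *: a k) (fun tau => F (c * tau)).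
Proof.
move=> c0 HF; apply: Otau_eq (Otau_dilate c0 HF) => tau _; congr (_ - _).
by apply: eq_bigr => k _; rewrite scalerA rmorphM exprMn mulrC.
Qed.

End Expansion.

Section ExpansionProduct.
Context {R : realType} {m n p : nat}.
Implicit Types (a : nat -> 'M[R[i]]_(m, n)) (F : R -> 'M[R[i]]_(m, n)) (d : nat).

(** Summing over a square that does not depend on [k] allows the sums over [i], [j] and [k] to be
    exchanged in the product rule. *)
Lemma mxconvE d a (b : nat -> 'M[R[i]]_(n, p)) k : (k < d)%N ->
  mxconv a b k = \sum_(i < d) \sum_(j < d) (if (i + j == k)%N then a i *m b j else 0).
Proof.
move=> kd; rewrite /mxconv (big_ord_widen _ (fun i => a i *m b (k - i)%N) kd).
rewrite big_mkcond; apply: eq_bigr => i _; rewrite ltnS; case: leqP => ik.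
  rewrite (bigD1 (Ordinal (leq_ltn_trans (leq_subr i k) kd))) //= subnKC // eqxx.
  rewrite big1 ?addr0 // => j; rewrite -val_eqE /= => /negPf jk.
  by rewrite -{1}(subnKC ik) eqn_add2l jk.
by rewrite big1 // => j _; rewrite gtn_eqF // (leq_trans ik) ?leq_addr.
Qed.

Lemma expansionM d a F (b : nat -> 'M[R[i]]_(n, p)) (G : R -> 'M[R[i]]_(n, p)) :
  expansion d a F -> expansion d b G ->
  expansion d (mxconv a b) (fun tau => F tau *m G tau).
Proof.
move=> HF HG.
pose A tau := \sum_(k < d) tau%:C ^+ k *: a k.
pose B tau := \sum_(k < d) tau%:C ^+ k *: b k.
(* F G - A B = (F - A) G + A (G - B), where [G] and [A] are bounded. *)
have H1 : Otau d (fun tau => F tau *m G tau - A tau *m B tau).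
  have := OtauM HF (expansion_bounded HG); rewrite addn0.
  have := OtauM (Otau_poly d a) HG; rewrite add0n => /OtauD/[apply].
  by apply: Otau_eq => tau _; rewrite mulmxBr mulmxBl addrC addrA subrK.
apply: Otau_expansion H1 _.
(* In the product of the two truncations, the pairs with [i + j < d] make up the convolution; the
   others are O(tau^d). *)
have : Otau d (fun tau => \sum_(i < d) \sum_(j < d)
    (if (i + j < d)%N then 0 else tau%:C ^+ (i + j) *: (a i *m b j))).
  apply: Otau_sum => i; apply: Otau_sum => j; case: ltnP => ijd; first exact: Otau0.
  by apply: Otau_le ijd _; exact: OtauX.
apply: Otau_eq => tau _.
rewrite /A /B mulmx_suml.
under [X in _ - X]eq_bigr => k _ do
  rewrite (mxconvE _ _ (ltn_ord k)) scaler_sumr.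
rewrite [X in _ - X]exchange_big -sumrB; apply: eq_bigr => i _.
under [X in _ - X]eq_bigr => k _ do rewrite scaler_sumr.
rewrite [X in _ - X]exchange_big mulmx_sumr -sumrB; apply: eq_bigr => j _ /=.
rewrite -scalemxAl -scalemxAr scalerA -exprD; case: ltnP => ijd.
  rewrite (bigD1 (Ordinal ijd)) //= eqxx big1 ?addr0 ?subrr // => k.
  by rewrite -val_eqE /= eq_sym => /negPf ->; rewrite scaler0.
rewrite big1 ?subr0 // => k _.
by rewrite gtn_eqF ?scaler0 // (leq_trans (ltn_ord k)).
Qed.

End ExpansionProduct.

(** * Term-by-term integration *)

Section Convergence.
Context {R : realType} {T : Type} {F : set_system T} {FF : Filter F}.

Lemma cvg_ReIm (f : T -> R[i]) (z : R[i]) : f @ F --> z <->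
  (fun x => Re (f x)) @ F --> Re z /\ (fun x => Im (f x)) @ F --> Im z.
Proof.
have ReB (x y : R[i]) : Re (x - y) = Re x - Re y by case: x; case: y.
have ImB (x y : R[i]) : Im (x - y) = Im x - Im y by case: x; case: y.
split=> [/cvgrPdist_lt fz|[/cvgrPdist_lt Ref /cvgrPdist_lt Imf]].
  split; apply/cvgrPdist_lt => e e0.
    have /fz : 0 < e%:C by rewrite ltcR.
    apply: filterS => x; rewrite -ReB -ltcR; exact: le_lt_trans (normRe_le _).
  have /fz : 0 < e%:C by rewrite ltcR.
  apply: filterS => x; rewrite -ImB -ltcR; exact: le_lt_trans (normIm_le _).
apply/cvgrPdist_lt => -[e e'] e0.
(* A positive element of [R[i]] is real. *)
have [e'0 {}e0] : e' = 0 /\ 0 < e by move: e0; rewrite ltcE => /andP[/eqP].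
have e20 : 0 < e / 2 by rewrite divr_gt0.
move: (Ref _ e20) (Imf _ e20); apply: filterS2 => x; rewrite -ReB -ImB => h1 h2.
rewrite e'0 (le_lt_trans (normc_le_absc _)) // ltcR /absc; lra.
Qed.

Lemma cvg_mxP m n (f : T -> 'M[R[i]]_(m, n)) (A : 'M[R[i]]_(m, n)) :
  f @ F --> A <-> forall i j, (fun x => f x i j) @ F --> A i j.
Proof.
split=> [fA i j|fA B [P PA PB]].
  exact: (@cvg_comp _ _ _ f (fun M : 'M[R[i]]_(m, n) => M i j) _ _ _ fA
    (@coord_continuous _ _ _ i j A)).
apply: (@filterS _ F _ (fun x => forall i j, P i j (f x i j))).
  by move=> x Px; exact: PB.
by apply: filter_forall => i; apply: filter_forall => j; exact: fA.
Qed.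

End Convergence.

Section Integration.
Context {R : realType} {m n : nat}.

(** Passes to real functions, for which the mean value theorem is available. The auxiliary [quot]
    treats both parts through an arbitrary real-linear [phi]. *)
Lemma is_derive_ReIm (F : R -> 'M[R[i]]_(m, n)) t i j : mxderivable F t ->
  is_derive t 1 (fun s => Re (F s i j)) (Re (mxderive1 F t i j)) /\
  is_derive t 1 (fun s => Im (F s i j)) (Im (mxderive1 F t i j)).
Proof.
move=> dF; have /cvg_mxP/(_ i j)/cvg_ReIm[cRe cIm] : mxquot F t @ 0^' --> mxderive1 F t.
  exact: dF.
have quot (phi : R[i] -> R) : (forall z w, phi (z - w) = phi z - phi w) ->
    (forall (r : R) z, phi (r%:C * z) = r * phi z) ->
    (fun h => phi (mxquot F t h i j)) @ 0^' --> phi (mxderive1 F t i j) ->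
    is_derive t 1 (fun s => phi (F s i j)) (phi (mxderive1 F t i j)).
  move=> phiB phiZ cphi.
  have E : (fun h : R => h^-1 *: (((fun s => phi (F s i j)) \o shift t) (h *: 1)
      - phi (F t i j))) = (fun h => phi (mxquot F t h i j)).
    by apply/funext => h; rewrite /mxquot !mxE phiZ phiB /= [h *: 1]mulr1.
  apply: DeriveDef; first by apply/cvg_ex; exists (phi (mxderive1 F t i j)); rewrite E.
  by apply: cvg_lim => //; rewrite E.
split; apply: quot => //.
- by move=> [a b] [c d].
- by move=> r [a b] /=; rewrite mul0r subr0.
- by move=> [a b] [c d].
- by move=> r [a b] /=; rewrite mul0r addr0.
Qed.

(** The mean value theorem is applied to [g], the difference of u(t + x) and an antiderivative [P]
    of the approximating polynomial: g(s) - g(0) = g'(c) s with [|c| <= |s|], and the bound on g'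
    gains one power of [|s|]. *)
Lemma taylor_integral (u du : R -> R) (a : nat -> R) (t C e : R) d :
  (forall s : R, is_derive s (1 : R) u (du s)) ->
  (forall s, s != 0 -> `|s| < e ->
    `|du (t + s) - \sum_(k < d) a k * s ^+ k| <= C * `|s| ^+ d) ->
  forall s, s != 0 -> `|s| < e ->
    `|u (t + s) - u t - \sum_(k < d) a k / k.+1%:R * s ^+ k.+1| <= C * `|s| ^+ d.+1.
Proof.
move=> du_ H s s0 se.
pose P : {poly R} := \sum_(k < d) (a k / k.+1%:R) *: 'X^(k.+1).
have PE x : P.[x] = \sum_(k < d) a k / k.+1%:R * x ^+ k.+1.
  by rewrite horner_sum; apply: eq_bigr => k _; rewrite !hornerE.
have P'E x : P^`().[x] = \sum_(k < d) a k * x ^+ k.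
  rewrite raddf_sum horner_sum; apply: eq_bigr => k _ /=.
  rewrite derivZ derivXn !hornerE hornerMn !hornerE /= -mulr_natr.
  by field.
pose g x := u (t + x) - P.[x].
have dg (x : R) : is_derive x (1 : R) g (du (t + x) - P^`().[x]).
  apply: is_deriveB; have := du_ (t + x).
  move=> h; have := @is_derive1_comp _ u (fun x => t + x) x (du (t + x)) 1.
  rewrite mulr1; apply => //.
  rewrite (_ : (fun x => t + x) = shift t); first exact: is_derive_shift.
  by apply/funext => y; rewrite /= addrC.
have cg : continuous g.
  by move=> x; apply: differentiable_continuous; apply/derivable1_diffP.
(* Forced by the hypothesis at [s] itself, since [|s| ^+ d > 0]. *)
have C0 : 0 <= C.
  have := le_trans (normr_ge0 _) (H s s0 se).
  by rewrite pmulr_lge0 // exprn_gt0 // normr_gt0.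
(* The interval is [0, s] or [s, 0] according to the sign of [s]. Its interior avoids 0, as the
   punctured bound on [du] demands. *)
have mvt : exists2 c, [/\ c != 0, `|c| <= `|s| & `|c| < e] &
    g s - g 0 = (du (t + c) - P^`().[c]) * s.
  have [s_gt0|s_lt0|/eqP] := ltgtP 0 s; last by rewrite eq_sym (negPf s0).
    have [c] := @MVT _ g _ 0 s s_gt0 (fun x _ => dg x) (continuous_subspaceT cg).
    rewrite in_itv /= => /andP[c0 cs] ->; exists c; last by rewrite subr0.
    by split; move: se; rewrite ?gt_eqF ?(gtr0_norm c0) ?(gtr0_norm s_gt0) ?(ltW cs) //; lra.
  have [c] := @MVT _ g _ s 0 s_lt0 (fun x _ => dg x) (continuous_subspaceT cg).
  rewrite in_itv /= => /andP[sc c0] gE.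
  exists c; last by rewrite -opprB gE sub0r mulrN opprK.
  by split; move: se; rewrite ?lt_eqF ?(ltr0_norm c0) ?(ltr0_norm s_lt0) //; lra.
have [c [c0 cs ce] gE] := mvt.
rewrite (_ : _ - _ - _ = g s - g 0); last first.
  rewrite /g !PE addr0 [X in - (_ - X)]big1 ?subr0 ?PE; first by ring.
  by move=> k _; rewrite expr0n mulr0.
rewrite gE normrM P'E exprSr mulrA ler_pM // (le_trans (H _ c0 ce)) //.
by rewrite ler_wpM2l // lerXn2r // nnegrE.
Qed.

Lemma expansion_integral d a (F : R -> 'M[R[i]]_(m, n)) t :
  (forall s, mxderivable F s) ->
  expansion d a (fun s => mxderive1 F (t + s)) ->
  expansion d.+1 (fun k => if k is k'.+1 then k'.+1%:R^-1 *: a k' else F t)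
    (fun s => F (t + s)).
Proof.
move=> dF [C /dnbhs0_near[e e0 H]].
(* One [C] for the real part and one for the imaginary part of each entry. *)
exists (\sum_(i < m) \sum_(j < n) (C + C)); apply/dnbhs0_near; exists e => // s s0 se.
rewrite /mxl1 mulr_suml ler_sum // => i _; rewrite mulr_suml ler_sum // => j _.
rewrite mulrDl.
pose b (k : nat) := if k is k'.+1 then k'.+1%:R^-1 *: a k' else F t.
have sumE (phi : R[i] -> R) k (c : nat -> 'M[R[i]]_(m, n)) x :
    {morph phi : z w / z + w} -> phi 0 = 0 ->
    (forall (r : R) z, phi (r%:C * z) = r * phi z) ->
    phi ((\sum_(l < k) x%:C ^+ l *: c l) i j) = \sum_(l < k) phi (c l i j) * x ^+ l.
  move=> phiD phi0 phiZ; rewrite summxE (big_morph _ phiD phi0).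
  by apply: eq_bigr => l _; rewrite mxE -rmorphXn phiZ mulrC.
have ReD : {morph (@Re R) : z w / z + w} by move=> [? ?] [].
have ImD : {morph (@Im R) : z w / z + w} by move=> [? ?] [].
have ReZ (r : R) z : Re (r%:C * z) = r * Re z by case: z => ? ? /=; rewrite mul0r subr0.
have ImZ (r : R) z : Im (r%:C * z) = r * Im z by case: z => ? ? /=; rewrite mul0r addr0.
have entry (phi : R[i] -> R) : {morph phi : z w / z + w} ->
    (forall (r : R) z, phi (r%:C * z) = r * phi z) ->
    (forall z, `|phi z| <= absc z) ->
    (forall x : R, is_derive x (1 : R) (fun s => phi (F s i j)) (phi (mxderive1 F x i j))) ->
    `|phi ((F (t + s) - \sum_(k < d.+1) s%:C ^+ k *: b k) i j)|
      <= C * `|s| ^+ d.+1.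
  move=> phiD phiZ phi_le dphi.
  have phi0 : phi 0 = 0 by rewrite -(mul0r 0) -(rmorph0 (real_complex R)) phiZ mul0r.
  have phiN z : phi (- z) = - phi z.
    by rewrite -mulN1r -(rmorphN1 (real_complex R)) phiZ mulN1r.
  rewrite mxE phiD [X in _ + phi X]mxE phiN.
  rewrite sumE //.
  rewrite big_ord_recl expr0 mulr1 opprD addrA.
  under eq_bigr => k _ do rewrite /= mxE -(rmorph_nat (real_complex R))
    -fmorphV phiZ [X in X * _]mulrC.
  apply: (taylor_integral (u := fun s => phi (F s i j)) (a := fun k => phi (a k i j)) dphi)
    s0 se => x x0 xe.
  rewrite -(sumE phi d a x) // -phiN -phiD.
  have -> : mxderive1 F (t + x) i j - (\sum_(l < d) x%:C ^+ l *: a l) i j =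
    (mxderive1 F (t + x) - \sum_(l < d) x%:C ^+ l *: a l) i j by rewrite !mxE.
  by rewrite (le_trans (phi_le _)) // (le_trans (absc_le_mxl1 _ _ _)) // H.
by apply: lerD; apply: entry => //; first [by move=> z; rewrite lerDl |
  by move=> z; rewrite lerDr | by move=> x; have [] := is_derive_ReIm i j (dF x)].
Qed.

End Integration.

(** * Taylor expansions of smooth functions and of exact solutions *)

Section Taylor.
Context {R : realType} {m n : nat}.
Implicit Types (F : R -> 'M[R[i]]_(m, n)) (t : R).

Lemma mxderivable_continuous F t : mxderivable F t -> {for t, continuous F}.
Proof.
move=> dF; apply/cvg_mxP => i j; have [dRe dIm] := is_derive_ReIm i j dF.
apply/cvg_ReIm; split.
  exact: (@differentiable_continuous _ _ _ t (fun s => Re (F s i j))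
    ((derivable1_diffP _ _).1 (@ex_derive _ _ _ _ _ _ _ dRe))).
exact: (@differentiable_continuous _ _ _ t (fun s => Im (F s i j))
  ((derivable1_diffP _ _).1 (@ex_derive _ _ _ _ _ _ _ dIm))).
Qed.

Lemma entry_le_norm (A : 'M[R[i]]_(m, n)) i j : `|A i j| <= `|A|.
Proof.
rewrite [leRHS]/Num.norm /= mx_normE -[leLHS]nngE num_le.
exact: (@le_bigmax _ _ _ _ (fun ij : 'I_m * 'I_n => `|A ij.1 ij.2|%:nng) (i, j)).
Qed.

(** Converse of [norm_le_mxl1] up to the factor 2mn; continuity only gives bounds in the
    max-norm. *)
Lemma mxl1_le_norm (A : 'M[R[i]]_(m, n)) (r : R) : `|A| <= r%:C ->
  mxl1 A <= \sum_(i < m) \sum_(j < n) (r + r).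
Proof.
move=> Ar; do 2![apply: ler_sum => ? _].
apply: lerD; rewrite -lecR; first apply: le_trans (normRe_le _) _.
  exact: le_trans (entry_le_norm _ _ _) Ar.
by apply: le_trans (normIm_le _) _; exact: le_trans (entry_le_norm _ _ _) Ar.
Qed.

Lemma continuous_Otau F t : {for t, continuous F} -> Otau 0 (fun s => F (t + s)).
Proof.
move=> /cvgrPdist_lt/(_ 1 ltr01)/nbhs_ballP[e /= e0 H].
(* The norm has values in [R[i]]; a real bound is extracted from it. *)
have /complex_realP[r0 r0E] : `|F t| \is Num.real by exact: normr_real.
pose r := r0 + 1.
exists (\sum_(i < m) \sum_(j < n) (r + r)); apply/dnbhs0_near; exists e => // s s0 se.
rewrite expr0 mulr1; apply: mxl1_le_norm.
have /H /= Fs : ball t e (t + s) by rewrite /ball /= opprD addrA subrr sub0r normrN.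
have -> : r%:C = `|F t| + 1 by rewrite r0E /r rmorphD rmorph1.
rewrite -[F (t + s)](subKr (F t)).
by apply: le_trans (ler_normB _ _) _; rewrite lerD2l ltW.
Qed.

(** Induction on [k]: the expansion of the derivative is integrated term by term. The base case is
    the local boundedness of a continuous function, so class C^k yields [k] coefficients and a
    remainder O(s^k). *)
Lemma mxCk_expansion k F t : mxCk k F ->
  expansion k (fun j => j`!%:R^-1 *: mxderiven j F t) (fun s => F (t + s)).
Proof.
elim: k F => [|k IHk] F [dF cF].
  apply: Otau_eq (continuous_Otau (cF t)) => tau _ /=.
  by rewrite big_ord0 subr0.
have /IHk/expansion_integral : mxCk k (mxderive1 F).
  split=> [j jk s|]; last by move: cF; rewrite /mxderiven iterSr.
  by have := dF j.+1 jk s; rewrite /mxderiven iterSr.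
move=> /(_ (fun s => dF 0%N isT s)); apply: expansion_eq => // -[|j] jk.
  by rewrite /mxderiven /= invr1 scale1r.
by rewrite scalerA /mxderiven iterSr factS natrM invfM.
Qed.

End Taylor.

(** Bootstrap: an expansion of [x] to order [e] gives one of [Q x] to order [e], and integrating x'
    = Q x raises the order by one. Thus [x] is known to one order more than [Q]. *)
Lemma exact_solution_expansion (R : realType) N (Q : R -> 'M[R[i]]_N)
    (x : R -> 'cV[R[i]]_N) (q : nat -> 'M[R[i]]_N) (c : nat -> 'cV[R[i]]_N) d t :
  exact_solution Q x -> expansion d q (fun s => Q (t + s)) ->
  c 0%N = x t ->
  (forall k, (k < d)%N -> c k.+1 = k.+1%:R^-1 *: mxconv q c k) ->
  expansion d.+1 c (fun s => x (t + s)).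
Proof.
move=> solx Qq c0 cS.
have dx s : mxderivable x s by have [] := solx s.
have x'E : (fun s => mxderive1 x (t + s)) = (fun s => Q (t + s) *m x (t + s)).
  by apply/funext => s; have [_ ->] := solx (t + s).
suff: forall e, (e <= d.+1)%N -> expansion e c (fun s => x (t + s)) by apply.
elim=> [_|e IHe ed].
  apply: Otau_eq (continuous_Otau (mxderivable_continuous (dx t))) => s _.
  by rewrite big_ord0 subr0.
have := expansionM (@expansion_le _ _ _ d e _ _ ed Qq) (IHe (ltnW ed)).
rewrite -x'E => /(expansion_integral dx); apply: expansion_eq => // -[|k] ke //.
by rewrite cS //; exact: leq_trans ke ed.
Qed.

(** * The matrix exponential *)

Section ExponentialTail.
Context {R : realType}.

(** Comparison with the exponential series. For the tail, (k + d)! >= k! gives a^(k+d) / (k + d)! <=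
    a^d a^k / k!, and the sum over [k] is at most a^d exp(a). *)
Lemma series_exp_tail (u : R^nat) (K a : R) : 0 <= a ->
  (forall k, `|u k| <= K * (a ^+ k / k`!%:R)) ->
  cvgn (series u) /\
  forall d, `|limn (series u) - series u d| <= K * a ^+ d * expR a.
Proof.
move=> a0 uK.
have K0 : 0 <= K by have := le_trans (normr_ge0 _) (uK 0%N); rewrite fact0 divr1 mulr1.
have cu : cvgn (series u).
  apply: normed_cvg.
  apply: (@series_le_cvg _ _ (K *: exp_coeff a)) => // [k|k|].
  - exact: normr_ge0.
  - by apply: mulr_ge0 => //; exact: exp_coeff_ge0.
  by apply: is_cvg_seriesZ; exact: is_cvg_series_exp_coeff.
split=> // d.
have lim_tail : `|series u M - series u d| @[M --> \oo] --> `|limn (series u) - series u d|.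
  by apply: cvg_norm; apply: cvgB cu (cvg_cst _).
apply: (cvgr_to_le lim_tail).
near=> M; have dM : (d <= M)%N by near: M; exact: nbhs_infty_ge.
have -> : series u M - series u d = \sum_(d <= k < M) u k.
  exact: (congr1 (fun f => f) (sub_series_geq u dM)).
apply: le_trans (ler_norm_sum _ _ _) _.
apply: (@le_trans _ _ (\sum_(d <= k < M) K * (a ^+ k / k`!%:R))).
  by apply: ler_sum => k _; exact: uK.
rewrite -mulr_sumr -mulrA ler_wpM2l // -{1}[d]add0n big_addn.
apply: (@le_trans _ _ (a ^+ d * series (exp_coeff a) (M - d)%N)).
  rewrite mulr_sumr; apply: ler_sum => k _ /=.
  rewrite exprD [_ * a ^+ d]mulrC -mulrA ler_wpM2l ?exprn_ge0 // ler_wpM2l ?exprn_ge0 //.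
  rewrite lef_pV2 ?posrE ?ltr0n ?fact_gt0 // ler_nat.
  elim: (d) => [|e IHe]; first by rewrite addn0.
  by rewrite addnS factS (leq_trans IHe) // leq_pmull.
rewrite ler_wpM2l ?exprn_ge0 //; apply: nondecreasing_cvgn_le.
  by apply: nondecreasing_series => k _ _; exact: exp_coeff_ge0.
exact: is_cvg_series_exp_coeff.
Unshelve. all: by end_near. Qed.

Context {N : nat}.
Implicit Types A : 'M[R[i]]_N.

Definition mxexp_term A (k : nat) : 'M[R[i]]_N := k`!%:R^-1 *: A ^+ k.

(** The extra factor accounts for [k = 0]: the identity has norm [N] here, not 1. *)
Lemma mxl1X A k : mxl1 (A ^+ k) <= mxl1 (1%:M : 'M[R[i]]_N) * mxl1 A ^+ k.
Proof.
elim: k => [|k IHk]; first by rewrite !expr0 mulr1.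
rewrite exprS (le_trans (mxl1M _ _)) // exprS mulrCA ler_wpM2l //; exact: mxl1_ge0.
Qed.

Lemma mxl1_exp_term A k :
  mxl1 (mxexp_term A k) <= mxl1 (1%:M : 'M[R[i]]_N) * (mxl1 A ^+ k / k`!%:R).
Proof.
rewrite /mxexp_term -(rmorph_nat (real_complex R)) -fmorphV mxl1ZR.
by rewrite ger0_norm ?invr_ge0 // mulrC mulrA ler_wpM2r ?invr_ge0 // mxl1X.
Qed.

(** [series_exp_tail] is applied to the real and the imaginary part of every entry, which explains
    the two equal summands per entry in the constant. *)
Lemma mxexp_cvg_tail A :
  series (mxexp_term A) @ \oo --> mxexp A /\
  forall d, mxl1 (mxexp A - \sum_(k < d) mxexp_term A k) <=
    (\sum_(i < N) \sum_(j < N)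
      (mxl1 (1%:M : 'M[R[i]]_N) + mxl1 (1%:M : 'M[R[i]]_N)))
    * mxl1 A ^+ d * expR (mxl1 A).
Proof.
set K := mxl1 (1%:M : 'M[R[i]]_N).
pose uRe i j k := Re (mxexp_term A k i j).
pose uIm i j k := Im (mxexp_term A k i j).
have bRe i j k : `|uRe i j k| <= K * (mxl1 A ^+ k / k`!%:R).
  apply: le_trans (mxl1_exp_term A k); apply: le_trans (absc_le_mxl1 _ i j).
  by rewrite /absc lerDl.
have bIm i j k : `|uIm i j k| <= K * (mxl1 A ^+ k / k`!%:R).
  apply: le_trans (mxl1_exp_term A k); apply: le_trans (absc_le_mxl1 _ i j).
  by rewrite /absc lerDr.
have tRe i j := series_exp_tail (mxl1_ge0 A) (bRe i j).
have tIm i j := series_exp_tail (mxl1_ge0 A) (bIm i j).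
have ReE i j d : Re (series (mxexp_term A) d i j) = series (uRe i j) d.
  rewrite /series /= summxE.
  by apply: (big_morph (@Re R)) => // -[? ?] [].
have ImE i j d : Im (series (mxexp_term A) d i j) = series (uIm i j) d.
  rewrite /series /= summxE.
  by apply: (big_morph (@Im R)) => // -[? ?] [].
pose L : 'M[R[i]]_N := \matrix_(i, j) (limn (series (uRe i j)) +i* limn (series (uIm i j))).
have cL : series (mxexp_term A) @ \oo --> L.
  apply/cvg_mxP => i j; apply/cvg_ReIm; rewrite mxE /=; split.
    rewrite (_ : (fun d => _) = series (uRe i j)); first exact: (tRe i j).1.
    by apply/funext => d; rewrite ReE.
  rewrite (_ : (fun d => _) = series (uIm i j)); first exact: (tIm i j).1.
  by apply/funext => d; rewrite ImE.
have expE : mxexp A = L by apply: cvg_lim cL; exact: norm_hausdorff.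
rewrite expE; split=> // d.
set a := mxl1 A; rewrite [leLHS]/mxl1 !mulr_suml ler_sum // => i _.
rewrite ler_sum // => j _.
rewrite !mulrDl /absc; have -> : \sum_(k < d) mxexp_term A k = series (mxexp_term A) d.
  by rewrite /series /= big_mkord.
have subRe (z w : R[i]) : Re (z - w) = Re z - Re w by case: z; case: w.
have subIm (z w : R[i]) : Im (z - w) = Im z - Im w by case: z; case: w.
have -> : (L - series (mxexp_term A) d) i j = L i j - series (mxexp_term A) d i j.
  by rewrite mxE; congr (_ + _); rewrite mxE.
rewrite subRe subIm ReE ImE [L i j]mxE /=.
by apply: lerD; [exact: (tRe i j).2|exact: (tIm i j).2].
Qed.

End ExponentialTail.

Section ExponentialExpansion.
Context {R : realType} {N : nat}.
Implicit Types (a : nat -> 'M[R[i]]_N) (F : R -> 'M[R[i]]_N) (d : nat).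

Lemma expansion_sum d (I : finType) (a : I -> nat -> 'M[R[i]]_N)
    (F : I -> R -> 'M[R[i]]_N) : (forall i, expansion d (a i) (F i)) ->
  expansion d (fun k => \sum_i a i k) (fun tau => \sum_i F i tau).
Proof.
move=> HF; apply: Otau_eq (Otau_sum HF) => tau _.
rewrite sumrB exchange_big; congr (_ - _).
by apply: eq_bigr => k _; rewrite scaler_sumr.
Qed.

Fixpoint mxconvX a k : nat -> 'M[R[i]]_N :=
  if k is k'.+1 then mxconv a (mxconvX a k') else fun j => if j is 0 then 1%:M else 0.

Lemma expansionX d a F k : expansion d a F ->
  expansion d (mxconvX a k) (fun tau => F tau ^+ k).
Proof.
move=> HF; elim: k => [|k IHk] /=.
  case: d HF => [|d] HF.
    by apply: Otau_eq (Otau_cst 1%:M) => tau _; rewrite big_ord0 subr0 expr0.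
  apply: expansion_eq (expansion_poly d.+1 _) => // tau _; rewrite expr0.
  rewrite big_ord_recl /= expr0 scale1r big1 ?addr0 // => k _.
  by rewrite scaler0.
have := expansionM HF IHk; apply: expansion_eq => // tau _.
by rewrite exprS.
Qed.

(** Since [a 0 = 0], [F] is O(tau), and the tail of the exponential series from [d] on is O(tau^d).
    The finitely many remaining powers are expanded by convolution. *)
Lemma mxexp_expansion d a F : (0 < d)%N -> a 0%N = 0 -> expansion d a F ->
  expansion d (fun j => \sum_(k < d) k`!%:R^-1 *: mxconvX a k j)
    (fun tau => mxexp (F tau)).
Proof.
move=> d0 a0 HF.
have [C C0 FO] : exists2 C : R, 0 <= C &
    \forall tau \near 0^', mxl1 (F tau) <= C * `|tau|.
  have F1 : Otau 1 F.
    apply: Otau_eq (expansion_le d0 HF) => tau _.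
    by rewrite big_ord1 a0 scaler0 subr0.
  by have [C C0 H] := Otau_ge0 F1; exists C.
apply: (@Otau_expansion _ _ _ d _ _
  (fun tau => \sum_(k < d) mxexp_term (F tau) k)).
  set D := \sum_(i < N) \sum_(j < N)
    (mxl1 (1%:M : 'M[R[i]]_N) + mxl1 (1%:M : 'M[R[i]]_N)).
  have D0 : 0 <= D by do 2![apply: sumr_ge0 => ? _]; rewrite addr_ge0 ?mxl1_ge0.
  (* For [|tau| <= 1] the factor exp(|F|) in the tail bound is at most exp(C). *)
  exists (D * C ^+ d * expR C).
  have tau1 : \forall tau \near (0 : R)^', `|tau| <= 1 by exact: dnbhs0_le.
  apply: filterS2 FO tau1 => tau Ftau tau1.
  apply: le_trans ((mxexp_cvg_tail (F tau)).2 d) _; rewrite -/D.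
  have FC : mxl1 (F tau) <= C by rewrite (le_trans Ftau) // ler_piMr.
  rewrite -[leRHS]mulrA [expR C * _]mulrC mulrA -[_ * C ^+ d * _]mulrA -exprMn.
  apply: ler_pM; rewrite ?ler_expR ?expR_ge0 ?mulr_ge0 ?exprn_ge0 ?mxl1_ge0 //.
  by rewrite ler_wpM2l // lerXn2r ?nnegrE ?mxl1_ge0 ?mulr_ge0.
by apply: expansion_sum => k; apply: expansionZ; exact: expansionX.
Qed.

End ExponentialExpansion.

(** * The five coefficients of the ES4 exponential *)

Lemma mxconv0E (K : pzSemiRingType) m n p (a : nat -> 'M[K]_(m, n)) (b : nat -> 'M[K]_(n, p)) :
  mxconv a b 0 = a 0%N *m b 0%N.
Proof. by rewrite /mxconv big_ord1. Qed.

Lemma mxconvS (K : pzSemiRingType) m n p (a : nat -> 'M[K]_(m, n)) (b : nat -> 'M[K]_(n, p)) k :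
  mxconv a b k.+1 = a 0%N *m b k.+1 + mxconv (fun i => a i.+1) b k.
Proof. by rewrite /mxconv big_ord_recl. Qed.

(** Once products are distributed and reassociated, each becomes a variable; the identity is then
    linear in them and [field] settles it entrywise. *)
Ltac generalize_products := repeat match goal with
  |- context [@mulmx ?R ?m ?n ?p ?A ?B] => move: (@mulmx R m n p A B) => ? end.

(** At t^4, Q0 [Q1, Q0] + [Q1, Q0] Q0 = Q1 Q0^2 - Q0^2 Q1, as the terms Q0 Q1 Q0 cancel. *)
Lemma ES4_expansion_coefs (K : numFieldType) (N : nat) (t : K) (Q0 Q1 Q2 B : 'M[K]_N) :
  B = 24%:R^-1 *: Q2 + 12%:R^-1 *: (Q1 *m Q0 - Q0 *m Q1) ->
  1%:M + t *: Q0 + t ^+ 2 *: (2%:R^-1 *: (Q0 *m Q0))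
    + t ^+ 3 *: (6%:R^-1 *: (Q0 *m (Q0 *m Q0)) + B)
    + t ^+ 4 *: (24%:R^-1 *: (Q0 *m (Q0 *m (Q0 *m Q0))) + 2%:R^-1 *: (Q0 *m B + B *m Q0))
  = 1%:M + t *: Q0 + (t ^+ 2 / 2%:R) *: (Q0 *m Q0)
    + (t ^+ 3 / 6%:R) *: (Q0 *m (Q0 *m Q0)) + (t ^+ 3 / 24%:R) *: Q2
    + (t ^+ 3 / 12%:R) *: (Q1 *m Q0 - Q0 *m Q1)
    + (t ^+ 4 / 24%:R) *: (Q0 *m (Q0 *m (Q0 *m Q0)))
    + (t ^+ 4 / 48%:R) *: (Q0 *m Q2 + Q2 *m Q0)
    + (t ^+ 4 / 24%:R) *: (Q1 *m (Q0 *m Q0) - (Q0 *m Q0) *m Q1).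
Proof.
move=> ->.
rewrite !(mulmxDl, mulmxDr, mulmxBl, mulmxBr) -?scalemxAl -?scalemxAr.
rewrite !(mulmxBl, mulmxBr) -!mulmxA.
generalize_products.
apply/matrixP => i j; rewrite !mxE.
by field.
Qed.

Section ES4.
Context {R : realType} {N : nat}.
Implicit Types (Q B : 'M[R[i]]_N).

(** Below tau^5, the exponential of tau Q + tau^3 B contains only powers of [Q], the term [B] at
    tau^3, and QB + BQ at tau^4, halved by the 2! of the quadratic term. *)
Lemma mxexp_expansion5 Q B (F : R -> 'M[R[i]]_N) :
  expansion 5 (nth 0 [:: 0; Q; 0; B; 0]) F ->
  expansion 5 (nth 0 [:: 1%:M; Q; 2%:R^-1 *: (Q *m Q); 6%:R^-1 *: (Q *m (Q *m Q)) + B;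
     24%:R^-1 *: (Q *m (Q *m (Q *m Q))) + 2%:R^-1 *: (Q *m B + B *m Q)])
    (fun tau => mxexp (F tau)).
Proof.
move=> /mxexp_expansion; move=> /(_ isT (erefl _)); apply: expansion_eq => // j j5.
under eq_bigr => k _.
  rewrite (_ : k`! = nth 1%N [:: 1; 1; 2; 6; 24]%N k); first over.
  by case: k => [[|[|[|[|[|]]]]]].
rewrite !big_ord_recl big_ord0 /= invr1.
set a := nth 0 [:: 0; Q; 0; B; 0].
(* Convolution with [a] only sees [a 1 = Q] and [a 3 = B]. *)
have a0 b : mxconv a b 0 = 0 by rewrite mxconv0E mul0mx.
have a1 b : mxconv a b 1 = Q *m b 0%N by rewrite mxconvS mxconv0E mul0mx add0r.
have a2 b : mxconv a b 2 = Q *m b 1%N.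
  by rewrite 2!mxconvS mxconv0E /= !mul0mx add0r addr0.
have a3 b : mxconv a b 3 = Q *m b 2%N + B *m b 0%N.
  by rewrite 3!mxconvS mxconv0E /= !mul0mx !add0r.
have a4 b : mxconv a b 4 = Q *m b 3%N + B *m b 1%N.
  by rewrite 4!mxconvS mxconv0E /= !mul0mx !add0r addr0.
move: j j5 => [|[|[|[|[|//]]]]] _ /=.
rewrite ?(a0, a1, a2, a3, a4) ?(mulmx1, mulmx0, add0r, addr0, scaler0, scale1r).
  done.
rewrite ?(a0, a1, a2, a3, a4) ?(mulmx1, mulmx0, add0r, addr0, scaler0, scale1r).
  done.
rewrite ?(a0, a1, a2, a3, a4) ?(mulmx1, mulmx0, add0r, addr0, scaler0, scale1r).
  done.
rewrite ?(a0, a1, a2, a3, a4) ?(mulmx1, mulmx0, add0r, addr0, scaler0, scale1r).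
  by rewrite addrC.
rewrite ?(a0, a1, a2, a3, a4) ?(mulmx1, mulmx0, add0r, addr0, scaler0, scale1r).
  by rewrite addrC.
Qed.

Lemma Otau_div k l m n (F : R -> 'M[R[i]]_(m, n)) :
  Otau (k + l) F -> Otau l (fun tau => (tau ^- k)%:C *: F tau).
Proof.
move=> [C /dnbhs0_near[e e0 H]]; exists C; apply/dnbhs0_near; exists e => //.
move=> tau tau0 taue; rewrite mxl1ZR normfV normrX ler_pdivrMl ?exprn_gt0 ?normr_gt0 //.
by rewrite mulrCA -exprD H.
Qed.

Definition ES4_cubic (Q0 Q1 Q2 : 'M[R[i]]_N) : 'M[R[i]]_N :=
  24%:R^-1 *: Q2 + 12%:R^-1 *: (Q1 *m Q0 - Q0 *m Q1).

Lemma ES4_exponent_expansion Q0 Q1 Q2 :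
  expansion 5 (nth 0 [:: 0; Q0; 0; ES4_cubic Q0 Q1 Q2; 0])
    (fun tau => ES4_exponent tau Q0 Q1 Q2).
Proof.
apply: expansion_eq (expansion_poly 5 _) => // tau _.
by rewrite !big_ord_recl big_ord0 /= !scaler0 !add0r !addr0 expr1.
Qed.

Lemma ES4_expansionE Q0 Q1 Q2 :
  expansion 5 (nth 0 [:: 1%:M; Q0; 2%:R^-1 *: (Q0 *m Q0);
     6%:R^-1 *: (Q0 *m (Q0 *m Q0)) + ES4_cubic Q0 Q1 Q2;
     24%:R^-1 *: (Q0 *m (Q0 *m (Q0 *m Q0)))
       + 2%:R^-1 *: (Q0 *m ES4_cubic Q0 Q1 Q2 + ES4_cubic Q0 Q1 Q2 *m Q0)])
    (fun tau => ES4_expansion tau Q0 Q1 Q2).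
Proof.
apply: expansion_eq (expansion_poly 5 _) => // tau _.
rewrite !big_ord_recl big_ord0 /= /bump !leq0n !add1n expr0 expr1 scale1r addr0.
move BE: (ES4_cubic Q0 Q1 Q2) => B.
rewrite !addrA (ES4_expansion_coefs _ (esym BE)).
by rewrite /ES4_expansion !exprS expr0 -!mulmxE !mulmx1.
Qed.

Lemma mxexp_ES4_exponent Q0 Q1 Q2 : Otau 5 (fun tau =>
  mxexp (ES4_exponent tau Q0 Q1 Q2) - ES4_expansion tau Q0 Q1 Q2).
Proof.
apply: expansion_Otau (ES4_expansionE _ _ _).
exact: mxexp_expansion5 (ES4_exponent_expansion _ _ _).
Qed.

End ES4.

(** * Fourth order of accuracy *)

Lemma mxconv_recursion (K : fieldType) N p (q : nat -> 'M[K]_N) (v : 'M[K]_(N, p)) :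
  exists2 c : nat -> 'M[K]_(N, p), c 0%N = v &
    forall k, c k.+1 = k.+1%:R^-1 *: mxconv q c k.
Proof.
(* Course-of-values recursion: [g n] is final on the indices up to [n], and the sequence sought is
   the diagonal. *)
pose fix g n : nat -> 'M[K]_(N, p) := if n is n'.+1 then
  fun k => if (k <= n')%N then g n' k else n'.+1%:R^-1 *: mxconv q (g n') n'
  else fun=> v.
have gE n k : (k <= n)%N -> g n k = g k k.
  elim: n => [|n IHn]; first by rewrite leqn0 => /eqP ->.
  by rewrite leq_eqVlt => /predU1P[-> //|]; rewrite ltnS /= => kn; rewrite kn IHn.
exists (fun k => g k k) => // k; rewrite /= ltnn; congr (_ *: _).
by apply: eq_bigr => i _; rewrite [in LHS]gE // leq_subr.
Qed.

(* [c 4] may stay unexpanded: it occurs on both sides with the factor 1/16. *)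
Lemma ES4_product_coefs (K : numFieldType) N p (q : nat -> 'M[K]_N)
    (c : nat -> 'M[K]_(N, p)) (Q0 Q1 Q2 B : 'M[K]_N) :
  q 0%N = Q0 -> q 1%N = Q1 -> q 2%N = 2%:R^-1 *: Q2 ->
  (forall k, c k.+1 = k.+1%:R^-1 *: mxconv q c k) ->
  B = 24%:R^-1 *: Q2 + 12%:R^-1 *: (Q1 *m Q0 - Q0 *m Q1) ->
  forall k, (k < 5)%N ->
  mxconv (nth 0 [:: 1%:M; Q0; 2%:R^-1 *: (Q0 *m Q0); 6%:R^-1 *: (Q0 *m (Q0 *m Q0)) + B;
     24%:R^-1 *: (Q0 *m (Q0 *m (Q0 *m Q0))) + 2%:R^-1 *: (Q0 *m B + B *m Q0)])
    (fun k => (- 2%:R^-1) ^+ k *: c k) k = 2%:R^-1 ^+ k *: c k.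
Proof.
move=> q0 q1 q2 cS BE.
have c1 : c 1%N = Q0 *m c 0%N by rewrite cS invr1 scale1r mxconv0E q0.
have c2 : c 2%N = 2%:R^-1 *: (Q0 *m c 1%N + Q1 *m c 0%N).
  by rewrite cS mxconvS mxconv0E q0 q1.
have c3 : c 3%N = 3%:R^-1 *: (Q0 *m c 2%N + Q1 *m c 1%N + 2%:R^-1 *: (Q2 *m c 0%N)).
  by rewrite cS 2!mxconvS mxconv0E q0 q1 q2 addrA -scalemxAl.
move=> [|[|[|[|[|//]]]]] _; rewrite !(mxconvS, mxconv0E) /= ?c3 ?c2 ?c1 ?BE mul1mx.
all: rewrite !expr0 ?expr1 ?scale1r //.
(* Pulling a scalar out of a product exposes a sum inside it, so distribution and extraction of
   scalars alternate. *)
all: do 4![rewrite ?(mulmxDl, mulmxDr, mulNmx, mulmxN) -?scalemxAl -?scalemxAr].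
all: rewrite -?mulmxA; generalize_products.
all: apply/matrixP => i j; rewrite !mxE.
all: by field.
Qed.

(** Under the antisymmetric difference the even coefficients cancel and 2 z q1 remains. The left
    side has the shape that unfolding the expansions produces. *)
Lemma difference_quotient1 (K : numFieldType) m n (z : K) (X Y q0 q1 q2 : 'M[K]_(m, n)) :
  z != 0 ->
  2^-1 *: (z^-1 *: (X + -1 *: Y - (z ^+ 0 *: (q0 + -1 *: ((-1) ^+ 0 *: q0)) +
    (z ^+ 1 *: (q1 + -1 *: ((-1) ^+ 1 *: q1)) +
      (z ^+ 2 *: (q2 + -1 *: ((-1) ^+ 2 *: q2)) + 0)))))
  = (2 * z)^-1 *: (X - Y) - q1.
Proof. by move=> z0; apply/matrixP => i j; rewrite !mxE; field. Qed.

(** Under the symmetric sum the odd coefficients cancel, leaving 2 q0 and 2 z^2 q2 = z^2 Q2. *)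
Lemma difference_quotient2 (K : numFieldType) m n (z : K) (X Y q0 q1 q2 q3 Q2 : 'M[K]_(m, n)) :
  z != 0 -> q2 = 2^-1 *: Q2 ->
  z ^- 2 *: (X + Y - (z ^+ 0 *: (q0 + (-1) ^+ 0 *: q0) +
    (z ^+ 1 *: (q1 + (-1) ^+ 1 *: q1) + (z ^+ 2 *: (q2 + (-1) ^+ 2 *: q2) +
      (z ^+ 3 *: (q3 + (-1) ^+ 3 *: q3) + 0)))))
  = z ^- 2 *: (X - 2 *: q0 + Y) - Q2.
Proof. by move=> z0 ->; apply/matrixP => i j; rewrite !mxE; field. Qed.

(** The exponent is affine in the pair of derivatives, so their errors enter linearly with the
    factor z^3. *)
Lemma ES4_exponentB (K : numFieldType) N (z : K) (Q0 D1 D2 Q1 Q2 : 'M[K]_N) :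
  z ^+ 3 *: (24^-1 *: (D2 - Q2) + 12^-1 *: ((D1 - Q1) *m Q0 - Q0 *m (D1 - Q1)))
  = z *: Q0 + z ^+ 3 *: (24^-1 *: D2 + 12^-1 *: (D1 *m Q0 - Q0 *m D1))
    - (z *: Q0 + z ^+ 3 *: (24^-1 *: Q2 + 12^-1 *: (Q1 *m Q0 - Q0 *m Q1))).
Proof.
rewrite mulmxBl mulmxBr; generalize_products.
by apply/matrixP => i j; rewrite !mxE; field.
Qed.

Section ES4Scheme.
Context {R : realType} {N : nat}.
Implicit Types (Q : R -> 'M[R[i]]_N) (t : R).

Lemma central_diff1_accuracy Q t (q : nat -> 'M[R[i]]_N) :
  expansion 3 q (fun s => Q (t + s)) ->
  Otau 2 (fun tau => central_diff1 Q t tau - q 1%N).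
Proof.
move=> Hq.
have N10 : (-1 : R) != 0 by rewrite oppr_eq0 oner_eq0.
have := expansionD Hq (expansionZ (-1) (expansion_dilate N10 Hq)).
(* The remainder O(tau^3) is divided by 2 tau. *)
move=> /(@Otau_div _ 1 2)/(OtauZ 2^-1); apply: Otau_eq => tau tau0.
have tau0C : tau%:C != 0 :> R[i] by rewrite fmorph_eq0.
rewrite /central_diff1 mulN1r !(fmorphV, rmorphM, rmorphN1, rmorph_nat) !big_ord_recl big_ord0 /=.
rewrite /bump !leq0n !add1n expr1; exact: difference_quotient1.
Qed.

Lemma central_diff2_accuracy Q t (q : nat -> 'M[R[i]]_N) (Q2 : 'M[R[i]]_N) :
  q 0%N = Q t ->
  q 2%N = 2%:R^-1 *: Q2 ->
  expansion 4 q (fun s => Q (t + s)) ->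
  Otau 2 (fun tau => central_diff2 Q t tau - Q2).
Proof.
move=> q0 q2 Hq.
have N10 : (-1 : R) != 0 by rewrite oppr_eq0 oner_eq0.
have := expansionD Hq (expansion_dilate N10 Hq).
(* The remainder O(tau^4) is divided by tau^2. *)
move=> /(@Otau_div _ 2 2); apply: Otau_eq => tau tau0.
have tau0C : tau%:C != 0 :> R[i] by rewrite fmorph_eq0.
rewrite /central_diff2 mulN1r !(fmorphV, rmorphXn, rmorphN1) !big_ord_recl big_ord0 /=.
rewrite /bump !leq0n !add1n -q0; exact: difference_quotient2 q2.
Qed.

(** Both differences are accurate to O(tau^2), and the exponent multiplies their errors by tau^3. *)
Lemma T_ES4_exponent_accuracy Q t : mxCk 4 Q ->
  Otau 5 (fun tau =>
    ES4_exponent tau (Q t) (central_diff1 Q t tau) (central_diff2 Q t tau)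
    - ES4_exponent tau (Q t) (mxderiven 1 Q t) (mxderiven 2 Q t)).
Proof.
move=> /(@mxCk_expansion _ _ _ _ _ t); set q := (fun j => _) => Qq.
have q0 : q 0%N = Q t by rewrite /q invr1 scale1r.
have q1 : q 1%N = mxderiven 1 Q t by rewrite /q invr1 scale1r.
have q2 : q 2%N = 2%:R^-1 *: mxderiven 2 Q t by [].
have := central_diff1_accuracy (@expansion_le _ _ _ 4 3 _ _ isT Qq); rewrite q1 => d1.
have d2 := central_diff2_accuracy q0 q2 Qq.
have d3 := OtauB (OtauM d1 (Otau_cst (Q t))) (OtauM (Otau_cst (Q t)) d1).
have := OtauXZ 3 (OtauD (OtauZ 24%:R^-1 d2) (OtauZ 12%:R^-1 d3)).
apply: Otau_eq => tau _; rewrite /ES4_exponent.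
move: (tau%:C) (Q t) (central_diff1 Q t tau) (central_diff2 Q t tau)
  (mxderiven 1 Q t) (mxderiven 2 Q t) => z Q0 D1 D2 Q1 Q2.
exact: ES4_exponentB.
Qed.

Lemma T_ES4_expansion Q t : mxCk 4 Q ->
  expansion 5 (nth 0 [:: 1%:M; Q t; 2%:R^-1 *: (Q t *m Q t);
     6%:R^-1 *: (Q t *m (Q t *m Q t)) + ES4_cubic (Q t) (mxderiven 1 Q t) (mxderiven 2 Q t);
     24%:R^-1 *: (Q t *m (Q t *m (Q t *m Q t)))
       + 2%:R^-1 *: (Q t *m ES4_cubic (Q t) (mxderiven 1 Q t) (mxderiven 2 Q t)
           + ES4_cubic (Q t) (mxderiven 1 Q t) (mxderiven 2 Q t) *m Q t)])
    (T_ES4 Q t).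
Proof.
move=> CQ; apply: mxexp_expansion5.
apply: Otau_expansion (T_ES4_exponent_accuracy t CQ) _.
exact: ES4_exponent_expansion.
Qed.

Lemma T_ES4_order Q : mxCk 4 Q -> order_of_accuracy 4 Q (T_ES4 Q).
Proof.
move=> CQ x solx t; apply: OtauP.
have Qq := mxCk_expansion t CQ; set q := (fun j => _) in Qq.
have q0 : q 0%N = Q t by rewrite /q invr1 scale1r.
have q1 : q 1%N = mxderiven 1 Q t by rewrite /q invr1 scale1r.
have q2 : q 2%N = 2%:R^-1 *: mxderiven 2 Q t by [].
have [c c0 cS] := mxconv_recursion q (x t).
have xc := exact_solution_expansion solx Qq c0 (fun k _ => cS k).
have V2C : (2^-1 : R)%:C = 2^-1 by rewrite fmorphV rmorph_nat.
have V2NC : (- 2^-1 : R)%:C = - 2^-1 by rewrite -V2C; exact: (rmorphN (real_complex R)).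
have V20 : (2^-1 : R) != 0 by rewrite invr_eq0 pnatr_eq0.
have V2N0 : (- 2^-1 : R) != 0 by rewrite oppr_eq0.
have xl := expansion_dilate V2N0 xc.
have xr := expansion_dilate V20 xc.
have Txl := expansionM (T_ES4_expansion t CQ) xl.
(* The coefficients of the product are those of x(t + tau/2), so the two sides agree up to
   O(tau^5). *)
have {}Txl : expansion 5 (fun k => (2^-1)%:C ^+ k *: c k)
    (fun tau => T_ES4 Q t tau *m x (t - tau / 2)).
  apply: expansion_eq Txl => [k k5|tau _]; last by rewrite mulNr mulrC.
  rewrite V2NC V2C.
  exact: (ES4_product_coefs q0 q1 q2 cS
    (erefl (ES4_cubic (Q t) (mxderiven 1 Q t) (mxderiven 2 Q t)))).
apply: Otau_eq (expansion_Otau xr Txl) => tau _.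
by rewrite [2^-1 * tau]mulrC.
Qed.

End ES4Scheme.

(** * The Zakharov-Shabat invariant *)

Section ZakharovShabatInvariant.
Context {R : realType}.
Implicit Types (sigma a b c mu : R).

(** Real coordinates on su(2) for [sigma = 1] and on su(1,1) for [sigma = -1]. *)
Definition su_mx sigma a b c : 'M[R[i]]_2 :=
  \matrix_(i < 2, j < 2)
    if i == 0 then (if j == 0 then 0 +i* a else b +i* c)
    else (if j == 0 then (- sigma * b) +i* (sigma * c) else 0 +i* (- a)).

Lemma matrix2P (K : Type) (A B : 'M[K]_2) :
  A 0 0 = B 0 0 -> A 0 1 = B 0 1 -> A 1 0 = B 1 0 -> A 1 1 = B 1 1 -> A = B.
Proof.
move=> H00 H01 H10 H11; apply/matrixP => i j.
have [->|->] : i = 0 \/ i = 1 by case: i => [[|[|//]]] ?; [left|right]; exact: val_inj.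
  by have [->|->] : j = 0 \/ j = 1 by case: j => [[|[|//]]] ?; [left|right]; exact: val_inj.
by have [->|->] : j = 0 \/ j = 1 by case: j => [[|[|//]]] ?; [left|right]; exact: val_inj.
Qed.

Lemma complex_eq (x y x' y' : R) : x = x' -> y = y' -> x +i* y = x' +i* y'.
Proof. by move=> -> ->. Qed.

Lemma su_mxD sigma a b c a' b' c' :
  su_mx sigma a b c + su_mx sigma a' b' c' = su_mx sigma (a + a') (b + b') (c + c').
Proof. by apply: matrix2P; rewrite !mxE /=; apply: complex_eq; ring. Qed.

Lemma su_mxB sigma a b c a' b' c' :
  su_mx sigma a b c - su_mx sigma a' b' c' = su_mx sigma (a - a') (b - b') (c - c').
Proof. by apply: matrix2P; rewrite !mxE /=; apply: complex_eq; ring. Qed.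

Lemma su_mxZ sigma (r : R) a b c :
  r%:C *: su_mx sigma a b c = su_mx sigma (r * a) (r * b) (r * c).
Proof. by apply: matrix2P; rewrite !mxE /=; apply: complex_eq; ring. Qed.

(** Closure under the commutator keeps the term Q1 Q - Q Q1 of the exponent in the Lie algebra. *)
Lemma su_mx_comm sigma a b c a' b' c' :
  su_mx sigma a b c *m su_mx sigma a' b' c' - su_mx sigma a' b' c' *m su_mx sigma a b c
  = su_mx sigma (- 2 * sigma * (c * b' - b * c'))
      (- 2 * (a * c' - a' * c)) (2 * (a * b' - a' * b)).
Proof.
by apply: matrix2P; rewrite !(mxE, big_ord_recl, big_ord0) /=; apply: complex_eq; ring.
Qed.

(** Cayley-Hamilton for a traceless matrix: A^2 = - det(A) E, with det(A) = a^2 + sigma (b^2 +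
    c^2). *)
Lemma su_mx_sqr sigma a b c : su_mx sigma a b c *m su_mx sigma a b c =
  (- a ^+ 2 - sigma * (b ^+ 2 + c ^+ 2))%:C%:M.
Proof.
by apply: matrix2P; rewrite !(mxE, big_ord_recl, big_ord0) /=; apply: complex_eq; ring.
Qed.

Lemma ZS_matrixE sigma (q : R -> R[i]) (xi t : R) :
  ZS_matrix sigma q xi%:C t = su_mx sigma (- xi) (Re (q t)) (Im (q t)).
Proof.
by apply: matrix2P; rewrite !mxE /=; case: (q t) => x y /=; apply: complex_eq; ring.
Qed.

(** The exponent is a real linear combination of values of [Q] and their commutators. The scalars
    are rewritten as images of reals so that [su_mxZ] applies. *)
Lemma ES4_exponent_ZS sigma q (xi t tau : R) (Q := ZS_matrix sigma q xi%:C) :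
  exists a b c, ES4_exponent tau (Q t) (central_diff1 Q t tau) (central_diff2 Q t tau)
    = su_mx sigma a b c.
Proof.
have V24 : 24%:R^-1 = (24%:R^-1 : R)%:C by rewrite fmorphV rmorph_nat.
have V12 : 12%:R^-1 = (12%:R^-1 : R)%:C by rewrite fmorphV rmorph_nat.
have n2 : 2%:R = (2%:R : R)%:C by rewrite rmorph_nat.
rewrite /ES4_exponent /central_diff1 /central_diff2 /Q !ZS_matrixE V24 V12 n2 -rmorphXn.
rewrite !(su_mxZ, su_mxD, su_mxB).
rewrite su_mx_comm !(su_mxZ, su_mxD).
by do 3!eexists.
Qed.

(* Written with mu^(k/2) instead of r^k, r = sqrt mu, since mu may be negative. *)
Definition exp_even mu (k : nat) : R := (~~ odd k)%:R * mu ^+ k./2 / k`!%:R.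
Definition exp_odd mu (k : nat) : R := (odd k)%:R * mu ^+ k./2 / k`!%:R.

(** Even powers of [A] are mu^m E and odd ones mu^m A, so the identity is already exact for partial
    sums. *)
Lemma series_exp_sqr N (A : 'M[R[i]]_N) mu n : A *m A = mu%:C%:M ->
  series (mxexp_term A) n =
    (series (exp_even mu) n)%:C%:M + (series (exp_odd mu) n)%:C *: A.
Proof.
move=> A2.
have AX k : A ^+ k = (mu ^+ k./2)%:C *: (if odd k then A else 1%:M).
  elim: k => [|k IHk]; first by rewrite expr0 scale1r.
  rewrite exprS IHk -mulmxE -scalemxAr /= uphalf_half; case: (odd k) => /=.
    by rewrite A2 !scale_scalar_mx mulr1 add1n exprSr (rmorphM (real_complex R)).
  by rewrite mulmx1.
elim: n => [|n IHn]; first by rewrite /series /= !big_geq // raddf0 scale0r addr0.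
rewrite /series /= !big_nat_recr //= -/(series _ _).
move: IHn; rewrite /series /= => ->.
rewrite !rmorphD /= scalerDl addrACA; congr (_ + _).
rewrite /mxexp_term AX scalerA /exp_even /exp_odd -(rmorph_nat (real_complex R)) -fmorphV -rmorphM.
case: (odd n) => /=.
  by rewrite !mul0r raddf0 add0r mul1r mulrC.
by rewrite !mul0r scale0r addr0 mul1r scale_scalar_mx mulr1 [_^-1 * _]mulrC.
Qed.

Lemma exp_even_odd_cvg mu :
  (fun n => series (exp_even mu) n ^+ 2 - mu * series (exp_odd mu) n ^+ 2) @ \oo --> (1 : R).
Proof.
have serD (u v w : R^nat) (r : R) : (forall k, w k = u k + r * v k) ->
    forall n, series w n = series u n + r * series v n.
  move=> H n; rewrite /series /= mulr_sumr -big_split.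
  by apply: eq_bigr => k _; exact: H.
have half (r : R) k : r ^+ k = (if odd k then r else 1) * (r ^+ 2) ^+ k./2.
  by rewrite -{1}(odd_double_half k) exprD -exprM mul2n; case: (odd k).
have [mu0|mu0] := leP 0 mu.
  (* C^2 - mu S^2 = (C + r S)(C - r S), a product of partial sums for exp(r) and exp(-r). *)
  pose r := Num.sqrt mu; have r2 : r ^+ 2 = mu by rewrite sqr_sqrtr.
  have Ep : forall n, series (exp_coeff r) n = series (exp_even mu) n + r * series (exp_odd mu) n.
    apply: serD => k; rewrite /exp_coeff /exp_even /exp_odd /= half r2.
    by case: (odd k) => /=; ring.
  have Em : forall n, series (exp_coeff (- r)) n =
      series (exp_even mu) n + (- r) * series (exp_odd mu) n.
    apply: serD => k; rewrite /exp_coeff /exp_even /exp_odd /= half sqrrN r2.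
    by case: (odd k) => /=; ring.
  rewrite (_ : (fun n => _) =
      (fun n => series (exp_coeff r) n * series (exp_coeff (- r)) n)).
    rewrite -(expRxMexpNx_1 r).
    by apply: cvgM; exact: is_cvg_series_exp_coeff.
  by apply/funext => n; rewrite Ep Em -r2; ring.
(* Now C and r S are the partial sums for cos(r) and sin(r), and -mu S^2 = (r S)^2. *)
pose r := Num.sqrt (- mu); have r2 : r ^+ 2 = - mu by rewrite sqr_sqrtr // oppr_ge0 ltW.
have half' (m : nat) : mu ^+ m = (-1) ^+ m * (r ^+ 2) ^+ m.
  by rewrite -exprMn r2 mulN1r opprK.
have Ec n : series (cos_coeff r) n = series (exp_even mu) n.
  rewrite -[RHS]addr0 -(mul0r (series (exp_odd mu) n)); move: n; apply: serD => k.
  rewrite /cos_coeff /exp_even /= half half' mul0r addr0 -exprnP.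
  by case: (odd k) => /=; ring.
have Es n : series (sin_coeff r) n = r * series (exp_odd mu) n.
  rewrite -[RHS]add0r; rewrite -[X in X + _](_ : series (fun=> 0 : R) n = 0); last first.
    by rewrite /series /= big1.
  move: n; apply: serD => k.
  rewrite /sin_coeff /exp_odd /= half half' add0r; case E: (odd k) => /=; last by ring.
  (* The sine coefficients halve [k.-1]; for odd [k] this is the same as halving [k]. *)
  suff -> : k.-1./2 = k./2 by ring.
  by case: k E => //= k; rewrite uphalf_half => /negPf ->.
rewrite (_ : (fun n => _) = (fun n => series (cos_coeff r) n ^+ 2 + series (sin_coeff r) n ^+ 2)).
  have cc : series (cos_coeff r) @ \oo --> cos r.
    by rewrite cos.unlock; exact: is_cvg_series_cos_coeff.
  have cs : series (sin_coeff r) @ \oo --> sin r.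
    by rewrite sin.unlock; exact: is_cvg_series_sin_coeff.
  by rewrite -(cos2Dsin2 r); exact: cvgD (cvgM cc cc) (cvgM cs cs).
by apply/funext => n; rewrite Ec Es exprMn r2; ring.
Qed.

(** As sigma^2 = 1, [A = su_mx sigma a b c] is skew-adjoint for the Hermitian form of the invariant,
    so C E + S A scales it by (C E - S A)(C E + S A) = (C^2 - mu S^2) E. The proof checks this in
    real coordinates. *)
Lemma ZS_invariant_su sigma a b c (C S : R) Psi : sigma = 1 \/ sigma = -1 ->
  ZS_invariant sigma ((C%:C%:M + S%:C *: su_mx sigma a b c) *m Psi) =
  (C ^+ 2 - (- a ^+ 2 - sigma * (b ^+ 2 + c ^+ 2)) * S ^+ 2)%:C * ZS_invariant sigma Psi.
Proof.
move=> sigma1; rewrite /ZS_invariant -!add_Re2_Im2 -!(rmorphM, rmorphD); congr (_%:C).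
rewrite !(mxE, big_ord_recl, big_ord0) /=.
case: (Psi 0 0) => p0 r0.
have -> : Psi (lift ord0 ord0) 0 = Psi 1 0 by congr (Psi _ _); exact: val_inj.
case: (Psi 1 0) => p1 r1 /=.
by case: sigma1 => -> /=; ring.
Qed.

Lemma ZS_invariant_cvg sigma (Psi : 'cV[R[i]]_2) (M : nat -> 'M[R[i]]_2) (L : 'M[R[i]]_2) :
  M @ \oo --> L ->
  (fun n => ZS_invariant sigma (M n *m Psi)) @ \oo --> ZS_invariant sigma (L *m Psi).
Proof.
move=> /cvg_mxP cM.
have cMPsi i : (fun n => `|(M n *m Psi) i 0| ^+ 2) @ \oo --> `|(L *m Psi) i 0| ^+ 2.
  have cs : (fun n => (M n *m Psi) i 0) @ \oo --> (L *m Psi) i 0.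
    rewrite mxE !big_ord_recl big_ord0; under eq_fun do rewrite mxE !big_ord_recl big_ord0.
    apply: cvgD; first exact: cvgM (cM _ _) (cvg_cst _).
    by apply: cvgD (cvg_cst _); exact: cvgM (cM _ _) (cvg_cst _).
  exact: cvgM (cvg_norm cs) (cvg_norm cs).
apply: cvgD; first exact: cMPsi.
by apply: cvgM; [exact: cvg_cst|exact: cMPsi].
Qed.

(** The invariant along the partial sums has two limits that must agree: one by continuity, the
    other because the scaling factor tends to 1. *)
Lemma ZS_invariant_mxexp sigma a b c Psi : sigma = 1 \/ sigma = -1 ->
  ZS_invariant sigma (mxexp (su_mx sigma a b c) *m Psi) = ZS_invariant sigma Psi.
Proof.
move=> sigma1; set A := su_mx sigma a b c.
set mu := - a ^+ 2 - sigma * (b ^+ 2 + c ^+ 2).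
have c1 := @ZS_invariant_cvg sigma Psi _ _ (mxexp_cvg_tail A).1.
suff c2 : (fun n => ZS_invariant sigma (series (mxexp_term A) n *m Psi)) @ \oo
    --> ZS_invariant sigma Psi.
  exact: (cvg_unique (@norm_hausdorff _ R[i]) c1 c2).
have c3 : (fun n => (series (exp_even mu) n ^+ 2 - mu * series (exp_odd mu) n ^+ 2)%:C)
    @ \oo --> (1 : R[i]).
  by apply/cvg_ReIm; split; [exact: exp_even_odd_cvg|exact: cvg_cst].
have -> : (fun n => ZS_invariant sigma (series (mxexp_term A) n *m Psi)) =
    (fun n => (series (exp_even mu) n ^+ 2 - mu * series (exp_odd mu) n ^+ 2)%:C
      * ZS_invariant sigma Psi).
  by apply/funext => n; rewrite (series_exp_sqr n (su_mx_sqr sigma a b c)) ZS_invariant_su.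
have c4 : (fun=> ZS_invariant sigma Psi) @ \oo --> ZS_invariant sigma Psi.
  exact: cvg_cst.
by rewrite -{2}[ZS_invariant sigma Psi]mul1r; exact: cvgM c3 c4.
Qed.

End ZakharovShabatInvariant.

Theorem mainTheorem4 (R : realType) :
  (forall (N : nat) (Q : R -> 'M[R[i]]_N), mxCk 4 Q ->
    (forall t : R,
      (fun tau : R =>
         mxexp (ES4_exponent tau (Q t) (mxderiven 1 Q t) (mxderiven 2 Q t))
         - ES4_expansion tau (Q t) (mxderiven 1 Q t) (mxderiven 2 Q t))
        =O_ (0^') (fun tau : R => tau%:C ^+ 5 : R[i]))
    /\ order_of_accuracy 4 Q (T_ES4 Q))
  /\
  (forall (sigma : R) (q : R -> R[i]) (xi t tau : R) (Psi : 'cV[R[i]]_2),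
    sigma = 1 \/ sigma = -1 -> tau != 0 ->
    ZS_invariant sigma (T_ES4 (ZS_matrix sigma q xi%:C) t tau *m Psi)
      = ZS_invariant sigma Psi).
Proof.
split=> [N Q CQ|sigma q xi t tau Psi sigma1 _].
  by split=> [t|]; [exact: OtauP (mxexp_ES4_exponent _ _ _)|exact: T_ES4_order].
rewrite /T_ES4; have [a [b [c ->]]] := ES4_exponent_ZS sigma q xi t tau.
exact: ZS_invariant_mxexp.
Qed.
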